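(* Smullyan's equivalence theorem, namely: ''Let $(A,B)$ be a disjoint pair of RE sets, and let $P$ be any one of the properties Kleene pair ($\mathsf{KP}$), having a separation function ($\mathsf{SF}$), $\mathsf{WEI}$, $\mathsf{CEI}$, semi-$\mathsf{DG}$, $\mathsf{DG}$, semi-$\mathsf{DU}$, $\mathsf{DU}$, $\mathsf{WDCP}$, $\mathsf{DCP}$; then $(A,B)$ has the property $P$ if and only if $(A,B)$ is $\mathsf{EI}$'', can be proved via the strong double recursion theorem as in the following diagram of implications (each implication being between properties of a disjoint pair $(A,B)$ of RE sets): $\mathsf{KP}\Rightarrow\mathsf{CEI}$, $\mathsf{CEI}\Rightarrow\mathsf{EI}$, $\mathsf{EI}\Rightarrow\mathsf{WEI}$, $\mathsf{WEI}\Rightarrow\mathsf{DG}$, $\mathsf{DG}\Rightarrow\mathsf{DCP}$, $\mathsf{DCP}\Rightarrow\mathsf{WDCP}$, $\mathsf{WDCP}\Rightarrow\mathsf{DU}$, $\mathsf{DU}\Rightarrow$ semi-$\mathsf{DU}$, semi-$\mathsf{DU}\Rightarrow\mathsf{SF}$, $\mathsf{SF}\Rightarrow\mathsf{KP}$, together with $\mathsf{DG}\Rightarrow$ semi-$\mathsf{DG}$ and semi-$\mathsf{DG}\Rightarrow\mathsf{KP}$.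
   Context: $W_i$ denotes the recursively enumerable (RE) subset of $\mathbb{N}$ with index $i$, i.e. $W_i=\{x:\exists y\,T_1(i,x,y)\}$ where $T_1$ is the Kleene predicate; ''recursive function'' means total computable function on $\mathbb{N}$. Strong double recursion theorem: for any RE relations $R_1(x,y_1,y_2,z_1,z_2)$ and $R_2(x,y_1,y_2,z_1,z_2)$, there are recursive functions $t_1(y_1,y_2)$ and $t_2(y_1,y_2)$ such that for all $i,j$: (1) $W_{t_1(i,j)}=\{x: R_1(x,i,j,t_1(i,j),t_2(i,j))\}$; (2) $W_{t_2(i,j)}=\{x: R_2(x,i,j,t_1(i,j),t_2(i,j))\}$. The properties of a disjoint pair $(A,B)$ of RE sets are defined as follows. $\mathsf{EI}$ (effectively inseparable): there is a recursive function $f(x,y)$ such that for all $i,j$, if $A\subseteq W_i$, $B\subseteq W_j$ and $W_i\cap W_j=\emptyset$, then $f(i,j)\notin W_i\cup W_j$. $\mathsf{SF}$ (has a separation function): there is a recursive function $S(x,y,z)$ such that for any RE relations $M_1(x,y)$ and $M_2(x,y)$ there is $h\in\mathbb{N}$ such that for all $x,y\in\mathbb{N}$: (i) $M_1(x,y)\wedge\neg M_2(x,y)\Rightarrow S(h,x,y)\in A$; (ii) $M_2(x,y)\wedge\neg M_1(x,y)\Rightarrow S(h,x,y)\in B$. $\mathsf{KP}$ (Kleene pair): there is a recursive function $f(x,y)$ such that for all $x,y$: (i) if $f(x,y)\in W_y\setminus W_x$, then $f(x,y)\in A$; (ii) if $f(x,y)\in W_x\setminus W_y$, then $f(x,y)\in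 B$. $\mathsf{WDCP}$ (weakly doubly co-productive): there is a recursive function $f(x,y)$ such that for all $i,j$: (i) if $W_i=W_j=\emptyset$, then $f(i,j)\notin A\cup B$; (ii) if $W_i=\emptyset$ and $W_j=\{f(i,j)\}$, then $f(i,j)\in B$; (iii) if $W_i=\{f(i,j)\}$ and $W_j=\emptyset$, then $f(i,j)\in A$. $\mathsf{DCP}$ (doubly co-productive): there is a recursive function $f(x,y)$ such that for all $i,j$, if $W_i\cap W_j=\emptyset$, $W_i\cap A=\emptyset$ and $W_j\cap B=\emptyset$, then $f(i,j)\notin A\cup B\cup W_i\cup W_j$. Semi-$\mathsf{DG}$: there is a recursive function $f(x,y)$ such that for all $i,j$, if $W_i\cap W_j=\emptyset$, then: (i) if $f(i,j)\in W_i$, then $f(i,j)\in A$; (ii) if $f(i,j)\in W_j$, then $f(i,j)\in B$. $\mathsf{DG}$ (doubly generative): there is a recursive function $f(x,y)$ such that for all $i,j$, if $W_i\cap W_j=\emptyset$, then: (i) $f(i,j)\in A$ iff $f(i,j)\in W_i$; (ii) $f(i,j)\in B$ iff $f(i,j)\in W_j$. Semi-$\mathsf{DU}$ (semi-doubly universal): every disjoint pair $(A',B')$ of RE sets is semi-reducible to $(A,B)$, i.e. there is a recursive function $f(x)$ such that $x\in A'$ implies $f(x)\in A$, and $x\in B'$ implies $f(x)\in B$. $\mathsf{DU}$ (doubly universal): every disjoint pair $(A',B')$ of RE sets is reducible to $(A,B)$, i.e. there is a recursive function $f(x)$ such that for all $x$, $x\in A'$ iff $f(x)\in A$, and $x\in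 B'$ iff $f(x)\in B$. $\mathsf{WEI}$ (weakly effectively inseparable): there is a recursive function $f(x,y)$ such that for all $i,j$: (i) if $W_i=A$ and $W_j=B$, then $f(i,j)\notin A\cup B$; (ii) if $W_i=A$ and $W_j=B\cup\{f(i,j)\}$, then $f(i,j)\in A$; (iii) if $W_i=A\cup\{f(i,j)\}$ and $W_j=B$, then $f(i,j)\in B$. $\mathsf{CEI}$ (completely effectively inseparable): there is a recursive function $f(x,y)$ such that for all $i,j$, if $A\subseteq W_i$ and $B\subseteq W_j$, then $f(i,j)\in W_i\Leftrightarrow f(i,j)\in W_j$. *)

(* Defs.v *)
From Stdlib Require Cantor.
From mathcomp Require Import all_boot.
From mathcomp Require Import boolp classical_sets.

Set Implicit Arguments.
Unset Strict Implicit.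
Unset Printing Implicit Defensive.

Local Open Scope classical_set_scope.

(* Derivations of partial mu-recursive functions. Terms carry no arity: they   *)
(* are run on argument lists of any length, a missing argument being read as  *)
(* 0. On lists of length n they compute exactly the n-ary partial recursive   *)
(* functions.                                                                 *)
Inductive recterm : Type :=
  | Zero
  | Succ
  | Proj (i : nat)
  | Comp (f : recterm) (gs : seq recterm)
  | Prec (f g : recterm)
  | Min (f : recterm).

Fixpoint all_some (os : seq (option nat)) : option (seq nat) :=
  match os with
  | [::] => Some [::]
  | Some r :: os' => omap (cons r) (all_some os')
  | None :: _ => None
  end.

(* The least y >= y0 with p y = Some 0, provided p is defined on the way;     *)
(* at most k values are tried.                                                *)
Fixpoint search (p : nat -> option nat) (k y0 : nat) : option nat :=
  match k with
  | 0 => None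
  | k'.+1 =>
      match p y0 with
      | Some 0 => Some y0
      | Some _.+1 => search p k' y0.+1
      | None => None
      end
  end.

(* run s c v is the value of c at v, if it is found within the bound s (on    *)
(* the recursion depth and on the length of searches); it is monotone in s.   *)
(* Prec f g is h with h(0,w) = f(w) and h(m+1,w) = g(m,h(m,w),w);             *)
(* Min f is v |-> mu y. f(y,v) = 0.                                           *)
Fixpoint run (s : nat) (c : recterm) (v : seq nat) : option nat :=
  match s with
  | 0 => None
  | s'.+1 =>
      match c with
      | Zero => Some 0
      | Succ => Some (head 0 v).+1
      | Proj i => Some (nth 0 v i)
      | Comp f gs =>
          obind (run s' f) (all_some [seq run s' g v | g <- gs])
      | Prec f g =>
          let w := behead v in
          match head 0 v with
          | 0 => run s' f w
          | m.+1 =>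
              obind (fun r => run s' g [:: m, r & w]) (run s' c (m :: w))
          end
      | Min f => search (fun y => run s' f (y :: v)) s' 0
      end
  end.

Definition computes (c : recterm) (v : seq nat) (r : nat) : Prop :=
  exists s, run s c v = Some r.

Definition recursive1 (f : nat -> nat) : Prop :=
  exists c, forall x, computes c [:: x] (f x).

Definition recursive2 (f : nat -> nat -> nat) : Prop :=
  exists c, forall x y, computes c [:: x; y] (f x y).

Definition recursive3 (f : nat -> nat -> nat -> nat) : Prop :=
  exists c, forall x y z, computes c [:: x; y; z] (f x y z).

Local Notation "<< x , y >>" := (Cantor.to_nat (x, y)).

Fixpoint goedel (c : recterm) : nat :=
  match c with
  | Zero => << 0, 0 >>
  | Succ => << 1, 0 >>
  | Proj i => << 2, i >>
  | Comp f gs =>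
      << 3, << goedel f, foldr (fun g n => << goedel g, n >>.+1) 0 gs >> >>
  | Prec f g => << 4, << goedel f, goedel g >> >>
  | Min f => << 5, goedel f >>
  end.

(* Kleene's predicate T_n(e, v, y), n being the length of v: e is the number  *)
(* of a term whose computation on v halts, as witnessed by y. Here y bounds   *)
(* the computation instead of coding it. Numbers that are not of the form     *)
(* goedel c are indices of the empty set.                                     *)
Definition kleeneT (e : nat) (v : seq nat) (y : nat) : Prop :=
  exists2 c, goedel c = e & run y c v <> None.

Definition W (i : nat) : set nat := [set x | exists y, kleeneT i [:: x] y].

Definition RE (A : set nat) : Prop := exists i, A = W i.

Definition RE2 (M : nat -> nat -> Prop) : Prop :=
  exists e, forall x y, M x y <-> exists z, kleeneT e [:: x; y] z.

Definition EI (A B : set nat) : Prop :=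
  exists2 f, recursive2 f &
    forall i j, A `<=` W i -> B `<=` W j -> W i `&` W j = set0 ->
      ~ (W i `|` W j) (f i j).

Definition SF (A B : set nat) : Prop :=
  exists2 S, recursive3 S &
    forall M1 M2, RE2 M1 -> RE2 M2 ->
      exists h, forall x y,
        (M1 x y /\ ~ M2 x y -> A (S h x y)) /\
        (M2 x y /\ ~ M1 x y -> B (S h x y)).

Definition KP (A B : set nat) : Prop :=
  exists2 f, recursive2 f &
    forall x y,
      ((W y `\` W x) (f x y) -> A (f x y)) /\
      ((W x `\` W y) (f x y) -> B (f x y)).

Definition WDCP (A B : set nat) : Prop :=
  exists2 f, recursive2 f &
    forall i j,
      [/\ W i = set0 -> W j = set0 -> ~ (A `|` B) (f i j),
          W i = set0 -> W j = [set f i j] -> B (f i j)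
        & W i = [set f i j] -> W j = set0 -> A (f i j)].

Definition DCP (A B : set nat) : Prop :=
  exists2 f, recursive2 f &
    forall i j,
      W i `&` W j = set0 -> W i `&` A = set0 -> W j `&` B = set0 ->
      ~ (A `|` B `|` W i `|` W j) (f i j).

Definition semiDG (A B : set nat) : Prop :=
  exists2 f, recursive2 f &
    forall i j, W i `&` W j = set0 ->
      (W i (f i j) -> A (f i j)) /\ (W j (f i j) -> B (f i j)).

Definition DG (A B : set nat) : Prop :=
  exists2 f, recursive2 f &
    forall i j, W i `&` W j = set0 ->
      (A (f i j) <-> W i (f i j)) /\ (B (f i j) <-> W j (f i j)).

Definition semi_reducible (A' B' A B : set nat) : Prop :=
  exists2 f, recursive1 f &
    forall x, (A' x -> A (f x)) /\ (B' x -> B (f x)).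

Definition reducible (A' B' A B : set nat) : Prop :=
  exists2 f, recursive1 f &
    forall x, (A' x <-> A (f x)) /\ (B' x <-> B (f x)).

Definition semiDU (A B : set nat) : Prop :=
  forall A' B', RE A' -> RE B' -> A' `&` B' = set0 ->
    semi_reducible A' B' A B.

Definition DU (A B : set nat) : Prop :=
  forall A' B', RE A' -> RE B' -> A' `&` B' = set0 ->
    reducible A' B' A B.

Definition WEI (A B : set nat) : Prop :=
  exists2 f, recursive2 f &
    forall i j,
      [/\ W i = A -> W j = B -> ~ (A `|` B) (f i j),
          W i = A -> W j = B `|` [set f i j] -> A (f i j)
        & W i = A `|` [set f i j] -> W j = B -> B (f i j)].

Definition CEI (A B : set nat) : Prop :=
  exists2 f, recursive2 f &
    forall i j, A `<=` W i -> B `<=` W j ->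
      (W i (f i j) <-> W j (f i j)).

(* Main.v *)
From Stdlib Require Cantor.
Require Import Defs.
From mathcomp Require Import all_boot.
From mathcomp Require Import boolp classical_sets.
From mathcomp Require Import zify.

(** All the properties are instances of one idea: an index may be built with
    knowledge of its own value, so a productive function f of (A, B) can be fed
    two sets W_t1 and W_t2 that talk about the number z = f(t1, t2) itself.
    Feeding WEI the sets A + {z if z is in W_j} and B + {z if z is in W_i}
    forces z to lie in A exactly when it lies in W_i and in B exactly when it
    lies in W_j, which is DG ([WEI_DG]). Feeding WDCP the sets that are {z} or
    empty according to whether y is in A' or in B' makes z a reduction of
    (A', B') to (A, B), which is DU ([WDCP_DU]). Both constructions are
    applications of the strong double recursion theorem ([double_recursion]).

    The steps semi-DU => SF and semi-DG => KP start from RE sets that may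
    overlap, whereas the hypotheses want disjoint ones. The overlap is removed
    by comparing stages: x is kept in the first set only if it is enumerated
    there strictly before it is in the second ([halts_first]). In SF => KP self
    reference costs nothing: the index h granted by SF may also be passed to the
    relations M1 and M2 as an argument. The other implications are
    propositional; the cycle from KP to KP, with its detour from DG through
    semi-DG, meets all the properties.

    What carries the recursion theory is the enumeration theorem
    ([halting_witnessP], [recursive3_halting_witness]): halting of the term
    number e on a coded list is the projection of a decidable relation. Halting
    is generated inductively by rules with at most two premises; a derivation
    by such rules is a list of facts in which each fact follows from two later
    ones, and a number coding such a list is recognised with bounded
    quantifiers ([derivable_certificate]). Given this, every relation used in
    the implications visibly has the form: there is p with D(p, ...), where D
    is computable. *)

Set Implicit Arguments.
Unset Strict Implicit.
Unset Printing Implicit Defensive.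

(** A named binary function, so that pairing is an application that the tactic
    [computability] can analyse, and that [simpl] does not unfold. *)
Definition cpair x y := Cantor.to_nat (x, y).
Arguments cpair : simpl never.
Local Notation "<< x , y >>" := (cpair x y).

(** * Evaluation of terms *)

Lemma all_someP os ws : all_some os = Some ws <-> os = map Some ws.
Proof.
split=> [|->]; last by elim: ws => //= w ws ->.
elim: os ws => [|[r|] os IH] [|w ws] //=.
- by case: all_some.
- by case E: all_some => [us|] //= [-> <-]; rewrite (IH us).
Qed.

Lemma all_some_mono T (g h : T -> option nat) xs ws :
  (forall x w, g x = Some w -> h x = Some w) ->
  all_some (map g xs) = Some ws -> all_some (map h xs) = Some ws.
Proof.
move=> gh; rewrite !all_someP; elim: xs ws => [|x xs IH] [|w ws] //= [gx e].
by rewrite (gh _ _ gx) (IH ws).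
Qed.

Lemma searchP p k y0 r :
  search p k y0 = Some r <->
  [/\ y0 <= r < y0 + k, p r = Some 0
    & forall y, y0 <= y < r -> exists q, p y = Some q.+1].
Proof.
elim: k y0 => [|k IH] y0 /=; first by split=> // -[]; lia.
split.
- case py: (p y0) => [[|q]|] //.
  + by case=> <-; split=> //; [lia | move=> y; lia].
  + case/IH=> le pr pos; split=> //; first lia.
    move=> y lt; have [->|ne] := eqVneq y y0; first by exists q.
    by apply: pos; lia.
- case=> le pr pos; have [e|ne] := eqVneq y0 r; first by rewrite e pr.
  have [|q ->] := pos y0; first lia.
  by apply/IH; split=> //; [lia | move=> y lt; apply: pos; lia].
Qed.

Lemma run_mono s s' c v r : s <= s' -> run s c v = Some r -> run s' c v = Some r.
Proof.
elim: s s' c v r => [//|s IH] [//|s'] c v r; rewrite ltnS => le.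
have {}IH c' v' r' : run s c' v' = Some r' -> run s' c' v' = Some r' by exact: IH.
case: c => //=.
- move=> f gs; case E: all_some => [ws|] //= fr.
  by rewrite (@all_some_mono _ (run s ^~ v) (run s' ^~ v) _ _ (IH^~ v) E) /= (IH _ _ _ fr).
- move=> f g; case: (head 0 v) => [|m]; first exact: IH.
  by case E: (run s _ _) => [q|] //= gr; rewrite (IH _ _ _ E) /= (IH _ _ _ gr).
- move=> f /searchP[lt fr pos]; apply/searchP; split; [lia | exact: IH |].
  by move=> y /pos[q fy]; exists q; exact: IH.
Qed.

Lemma computes_det c v r r' : computes c v r -> computes c v r' -> r = r'.
Proof.
case=> s cr [s' cr'].
have := run_mono (leq_maxl s s') cr.
by rewrite (run_mono (leq_maxr s s') cr') => -[].
Qed.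

Lemma computes_Zero v : computes Zero v 0.
Proof. by exists 1. Qed.

Lemma computes_Succ v : computes Succ v (head 0 v).+1.
Proof. by exists 1. Qed.

Lemma computes_Proj i v : computes (Proj i) v (nth 0 v i).
Proof. by exists 1. Qed.

Lemma computes_all gs v ws :
  List.Forall2 (fun g w => computes g v w) gs ws <->
  exists s, all_some [seq run s g v | g <- gs] = Some ws.
Proof.
split=> [|[s]].
- elim=> [|g w {}gs {}ws [s gw] _ [s' IH]]; first by exists 0.
  exists (maxn s s'); rewrite /= (run_mono (leq_maxl s s') gw).
  have le c r : run s' c v = Some r -> run (maxn s s') c v = Some r.
    exact: run_mono (leq_maxr s s').
  by rewrite (all_some_mono le IH).
- rewrite all_someP; elim: gs ws => [|g gs IH] [|w ws] //= [gw /IH].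
  by constructor=> //; exists s.
Qed.

Lemma computes_Comp f gs v r :
  computes (Comp f gs) v r <->
  exists2 ws, List.Forall2 (fun g w => computes g v w) gs ws & computes f ws r.
Proof.
split=> [[[//|s] /=]|[ws /computes_all[s gws] [s' fr]]].
- case E: all_some => [ws|] //= fr.
  by exists ws; [apply/computes_all; exists s | exists s].
- exists (maxn s s').+1 => /=.
  have le c q : run s c v = Some q -> run (maxn s s') c v = Some q.
    exact: run_mono (leq_maxl s s').
  by rewrite (all_some_mono le gws) /= (run_mono (leq_maxr s s') fr).
Qed.

Lemma computes_all_det gs v ws us :
  List.Forall2 (fun g w => computes g v w) gs ws ->
  List.Forall2 (fun g w => computes g v w) gs us -> ws = us.
Proof.
move=> gsws; elim: gsws us => [|g w {}gs {}ws gw _ IH] us H; inversion H => //; subst.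
by congr cons; [exact: computes_det gw _ | exact: IH].
Qed.

Lemma computes_Prec0 f g v r :
  head 0 v = 0 -> computes f (behead v) r -> computes (Prec f g) v r.
Proof. by move=> v0 [s fr]; exists s.+1; rewrite /= v0. Qed.

Lemma computes_PrecS f g m v q r :
  head 0 v = m.+1 -> computes (Prec f g) (m :: behead v) q ->
  computes g [:: m, q & behead v] r -> computes (Prec f g) v r.
Proof.
move=> vm [s fq] [s' gr]; exists (maxn s s').+1; rewrite /= vm.
by rewrite (run_mono (leq_maxl s s') fq) /= (run_mono (leq_maxr s s') gr).
Qed.

Lemma computes_Min f v r :
  computes (Min f) v r <->
  computes f (r :: v) 0 /\ forall y, y < r -> exists q, computes f (y :: v) q.+1.
Proof.
split=> [[[//|s] /= /searchP[_ fr pos]]|[[s fr] pos]].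
- by split=> [|y lt]; [exists s | have [//|q fy] := pos y; exists q, s].
- have [s' {}pos] : exists s', forall y, y < r -> exists q, run s' f (y :: v) = Some q.+1.
    elim: {fr} r pos => [|r IH] pos; first by exists 0.
    have [y lt|s' IHs] := IH; first by apply: pos; lia.
    have [//|q [t fq]] := pos r.
    exists (maxn t s') => y; rewrite ltnS leq_eqVlt => /orP[/eqP->|/IHs[q' fy]].
      by exists q; exact: run_mono (leq_maxl _ _) fq.
    by exists q'; exact: run_mono (leq_maxr _ _) fy.
  have [N ltN] : exists N, r + s + s' < N by exists (r + s + s').+1.
  exists N.+1; apply/searchP; split; first lia.
    by apply: (run_mono _ fr); lia.
  by move=> y /pos[q fy]; exists q; apply: (run_mono _ fy); lia.
Qed.

(** The generated principle gives no hypothesis on the terms in the list under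
    [Comp]. *)
Lemma recterm_nested_ind (P : recterm -> Prop) :
  P Zero -> P Succ -> (forall i, P (Proj i)) ->
  (forall f gs, P f -> List.Forall P gs -> P (Comp f gs)) ->
  (forall f g, P f -> P g -> P (Prec f g)) ->
  (forall f, P f -> P (Min f)) ->
  forall c, P c.
Proof.
move=> PZ PS Pp PC PP PM; fix IH 1; case=> [||i|f gs|f g|f].
- exact: PZ.
- exact: PS.
- exact: Pp.
- by apply: PC; [exact: IH | elim: gs => [|g gs IHgs]; constructor].
- by apply: PP.
- exact: PM.
Qed.

(** * Computable functions *)

(** Open expressions in n variables are functions of an environment of size n.
    The size has to be fixed because [Comp] can pass only a fixed number of
    arguments on to a term. *)
Definition computable n (f : seq nat -> nat) :=
  exists c, forall v, size v = n -> computes c v (f v).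

Definition var i (v : seq nat) := nth 0 v i.

Lemma computable_ext n f g :
  (forall v, size v = n -> f v = g v) -> computable n f -> computable n g.
Proof. by move=> fg [c cf]; exists c => v sv; rewrite -fg //; exact: cf. Qed.

Lemma computable_comp n f gs :
  computable (size gs) f -> List.Forall (computable n) gs ->
  computable n (fun v => f [seq g v | g <- gs]).
Proof.
case=> cf f_ok gs_ok.
have [cs cs_ok] : exists cs, forall v, size v = n ->
    List.Forall2 (fun c w => computes c v w) cs [seq g v | g <- gs].
  elim: gs_ok => {f_ok} [|g hs [c c_ok] _ [cs cs_ok]]; first by exists [::].
  by exists (c :: cs) => v sv; constructor; [exact: c_ok | exact: cs_ok].
exists (Comp cf cs) => v sv; apply/computes_Comp; eexists; first exact: cs_ok.
by apply: f_ok; rewrite size_map.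
Qed.

Lemma computable_var n i : computable n (var i).
Proof. by exists (Proj i) => v _; exact: computes_Proj. Qed.

(** This is how a term evaluates its argument in a tail of the environment. *)
Lemma map_vars u v :
  [seq g (u ++ v) | g <- [seq var i | i <- iota (size u) (size v)]] = v.
Proof.
rewrite -[size u]addn0 iotaDl -!map_comp -[RHS](mkseq_nth 0).
by apply: eq_map => i; rewrite /= /var nth_cat ltnNge leq_addr addKn.
Qed.

(** Together with its iterates below, this interprets de Bruijn shifts: under a
    binder the environment grows at the head. *)
Lemma computable_weaken n f :
  computable n f -> computable n.+1 (fun w => f (behead w)).
Proof.
case=> c c_ok; have [|//|d d_ok] := @computable_comp n.+1 f [seq var i | i <- iota 1 n].
- by exists c => v; rewrite size_map size_iota; exact: c_ok.
- by elim: (iota 1 n) => [|i s IH]; constructor=> //; exact: computable_var.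
exists d => -[//|x v] [sv]; have := d_ok (x :: v).
by rewrite /= -{1 2}sv (map_vars [:: x]) => /(_ erefl).
Qed.

Lemma computable_rec n (N F : seq nat -> nat) (G : nat -> nat -> seq nat -> nat) :
  computable n N -> computable n F ->
  computable n.+2 (fun w => G (var 0 w) (var 1 w) (behead (behead w))) ->
  computable n (fun v => iteri (N v) (fun m r => G m r v) (F v)).
Proof.
move=> cN [cF F_ok] [cG G_ok].
pose h w := iteri (var 0 w) (fun m r => G m r (behead w)) (F (behead w)).
have H : computable n.+1 h.
  exists (Prec cF cG) => -[//|m v] [sv] /=; rewrite /h /var /=.
  elim: m => [|m IH]; first by apply: computes_Prec0 => //; exact: F_ok.
  apply: (@computes_PrecS _ _ m (m.+1 :: v) _ _ erefl IH).
  by apply: (G_ok [:: m, _ & v]); rewrite /= sv.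
have [||c c_ok] := @computable_comp n h (N :: [seq var i | i <- iota 0 n]).
- by rewrite /= size_map size_iota; exact: H.
- by constructor=> //; elim: (iota 0 n) => [|i s IH]; constructor=> //; exact: computable_var.
by exists c => v sv; have := c_ok v sv; rewrite /= -{1}sv (map_vars [::]).
Qed.

Lemma computable_const n k : computable n (fun=> k).
Proof.
elim: k => [|k [c c_ok]]; first by exists Zero => v _; exact: computes_Zero.
exists (Comp Succ [:: c]) => v sv; apply/computes_Comp; exists [:: k].
  by constructor=> //; exact: c_ok.
exact: computes_Succ.
Qed.

Lemma recursive1P f : recursive1 f <-> computable 1 (fun v => f (var 0 v)).
Proof.
split=> -[c c_ok]; exists c; first by case=> [//|x [|//]] _; exact: c_ok.
by move=> x; exact: (c_ok [:: x]).
Qed.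

Lemma recursive2P f : recursive2 f <-> computable 2 (fun v => f (var 0 v) (var 1 v)).
Proof.
split=> -[c c_ok]; exists c; first by case=> [//|x [|y [|//]]] // _; exact: c_ok.
by move=> x y; exact: (c_ok [:: x; y]).
Qed.

Lemma recursive3P f :
  recursive3 f <-> computable 3 (fun v => f (var 0 v) (var 1 v) (var 2 v)).
Proof.
split=> -[c c_ok]; exists c; first by case=> [//|x [|y [|z [|//]]]] // _; exact: c_ok.
by move=> x y z; exact: (c_ok [:: x; y; z]).
Qed.

(** The [computable_app] lemmas substitute open expressions into a named
    recursive function. *)
Lemma computable_app1 n f a :
  recursive1 f -> computable n a -> computable n (fun v => f (a v)).
Proof.
move=> /recursive1P cf ca.
by apply: (@computable_comp n (fun w => f (var 0 w)) [:: a]); repeat constructor.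
Qed.

Lemma computable_app2 n f a b :
  recursive2 f -> computable n a -> computable n b ->
  computable n (fun v => f (a v) (b v)).
Proof.
move=> /recursive2P cf ca cb.
by apply: (@computable_comp n (fun w => f (var 0 w) (var 1 w)) [:: a; b]); repeat constructor.
Qed.

Lemma computable_app3 n f a b c :
  recursive3 f -> computable n a -> computable n b -> computable n c ->
  computable n (fun v => f (a v) (b v) (c v)).
Proof.
move=> /recursive3P cf ca cb cc.
by apply: (@computable_comp n (fun w => f (var 0 w) (var 1 w) (var 2 w)) [:: a; b; c]);
  repeat constructor.
Qed.

Lemma computable_weaken2 n f :
  computable n f -> computable n.+2 (fun w => f (behead (behead w))).
Proof. by move=> cf; exact: computable_weaken (computable_weaken cf). Qed.

Lemma computable_weaken3 n f :
  computable n f -> computable n.+3 (fun w => f (behead (behead (behead w)))).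
Proof. by move=> cf; exact: computable_weaken (computable_weaken2 cf). Qed.

Create HintDb computability.

(** Rules for connectives and iteration. It starts empty because [computability]
    takes part in proving them. *)
Ltac computability_rule := fail.

(** Proves that an expression is computable by following its syntax: variables,
    constants and shifts are leaves, [computability_rule] treats connectives and
    iteration, and any other head symbol must be a recursive function known to
    the hint database or to the context. *)
Ltac computability :=
  cbv beta;
  lazymatch goal with
  | |- recursive1 _ =>
      first [ assumption | solve [auto 2 with computability nocore]
            | apply/recursive1P; computability ]
  | |- recursive2 _ =>
      first [ assumption | solve [auto 2 with computability nocore]
            | apply/recursive2P; computability ]
  | |- recursive3 _ =>
      first [ assumption | solve [auto 2 with computability nocore]
            | apply/recursive3P; computability ]
  | |- computable _ _ =>
      first
      [ assumption
      | simple apply computable_const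
      | simple apply computable_var
      | simple apply computable_weaken; computability
      | simple apply computable_weaken2; computability
      | simple apply computable_weaken3; computability
      | computability_rule; computability
      | lazymatch goal with
        | |- computable _ (fun v => nat_of_bool (?f (@?a v) (@?b v) (@?c v))) =>
            apply (@computable_app3 _ (fun x y z => nat_of_bool (f x y z)) a b c);
              [solve [auto 2 with computability nocore] | computability ..]
        | |- computable _ (fun v => nat_of_bool (?f (@?a v) (@?b v))) =>
            apply (@computable_app2 _ (fun x y => nat_of_bool (f x y)) a b);
              [solve [auto 2 with computability nocore] | computability ..]
        | |- computable _ (fun v => nat_of_bool (?f (@?a v))) =>
            apply (@computable_app1 _ (fun x => nat_of_bool (f x)) a);
              [solve [auto 2 with computability nocore] | computability ..]
        | |- computable _ (fun v => ?f (@?a v) (@?b v) (@?c v)) =>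
            apply (@computable_app3 _ f a b c);
              [solve [auto 2 with computability nocore] | computability ..]
        | |- computable _ (fun v => ?f (@?a v) (@?b v)) =>
            apply (@computable_app2 _ f a b);
              [solve [auto 2 with computability nocore] | computability ..]
        | |- computable _ (fun v => ?f (@?a v)) =>
            apply (@computable_app1 _ f a);
              [solve [auto 2 with computability nocore] | computability ..]
        end ]
  end.

Lemma recursive1_S : recursive1 S.
Proof. by exists Succ => x; exact: computes_Succ. Qed.
#[local] Hint Resolve recursive1_S : computability.

Lemma computable_iter n N F g :
  recursive1 g -> computable n N -> computable n F ->
  computable n (fun v => iter (N v) g (F v)).
Proof.
move=> rg cN cF; apply: (@computable_ext _ (fun v => iteri (N v) (fun=> g) (F v))).
  by move=> v _; elim: (N v) => //= m ->.
apply: (@computable_rec _ _ _ (fun _ r _ => g r)); computability.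
Qed.

Lemma recursive2_add : recursive2 addn.
Proof.
apply/recursive2P; apply: (@computable_ext _ (fun v => iter (var 0 v) S (var 1 v))).
  by move=> v _; rewrite iter_succn addnC.
by apply: computable_iter; computability.
Qed.
#[local] Hint Resolve recursive2_add : computability.

Lemma recursive1_pred : recursive1 predn.
Proof.
apply/recursive1P; apply: (@computable_ext _ (fun v => iteri (var 0 v) (fun m _ => m) 0)).
  by move=> v _; case: (var 0 v).
by apply: (@computable_rec _ _ _ (fun m _ _ => m)); computability.
Qed.
#[local] Hint Resolve recursive1_pred : computability.

Lemma recursive2_sub : recursive2 subn.
Proof.
apply/recursive2P; apply: (@computable_ext _ (fun v => iter (var 1 v) predn (var 0 v))).
  by move=> v _; rewrite iter_predn.
by apply: computable_iter; computability.
Qed.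
#[local] Hint Resolve recursive2_sub : computability.

Lemma computable_if n b f g :
  computable n (fun v => b v : bool) -> computable n f -> computable n g ->
  computable n (fun v => if b v then f v else g v).
Proof.
move=> cb cf cg; apply: (@computable_ext _ (fun v => iteri (b v) (fun _ _ => f v) (g v))).
  by move=> v _; case: (b v).
by apply: (@computable_rec _ _ _ (fun _ _ v => f v)); computability.
Qed.

Lemma computable_negb n b :
  computable n (fun v => b v : bool) -> computable n (fun v => ~~ b v).
Proof.
move=> cb; apply: (@computable_ext _ (fun v => if b v then 0 else 1)).
  by move=> v _; case: (b v).
by apply: computable_if; computability.
Qed.

Lemma computable_andb n b b' :
  computable n (fun v => b v : bool) -> computable n (fun v => b' v : bool) ->
  computable n (fun v => b v && b' v).
Proof.
move=> cb cb'; apply: (@computable_ext _ (fun v => if b v then b' v : nat else 0)).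
  by move=> v _; case: (b v).
by apply: computable_if; computability.
Qed.

Lemma computable_orb n b b' :
  computable n (fun v => b v : bool) -> computable n (fun v => b' v : bool) ->
  computable n (fun v => b v || b' v).
Proof.
move=> cb cb'; apply: (@computable_ext _ (fun v => if b v then 1 else b' v)).
  by move=> v _; case: (b v).
by apply: computable_if; computability.
Qed.

Lemma computable_eqn n f g :
  computable n f -> computable n g -> computable n (fun v => f v == g v).
Proof.
move=> cf cg; apply: (@computable_ext _ (fun v => 1 - ((f v - g v) + (g v - f v)))).
  by move=> v _; case: eqP; lia.
by computability.
Qed.

Lemma computable_all n N (P : nat -> seq nat -> bool) :
  computable n N -> computable n.+1 (fun w => P (var 0 w) (behead w)) ->
  computable n (fun v => all (fun k => P k v) (iota 0 (N v))).
Proof.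
move=> cN cP; apply: (@computable_ext _ (fun v =>
    iteri (N v) (fun k r => if P k v then r else 0) 1)).
  move=> v _; elim: (N v) => // m IH.
  rewrite -[in iota _ _]addn1 iotaD all_cat /= IH add0n andbT.
  by case: (P m v); case: (all _ _).
apply: (@computable_rec _ _ _ (fun k r v => if P k v then r else 0)); try computability.
apply: computable_if; try computability.
(* The recursion puts its accumulator between k and the environment: drop it. *)
case: cP => c c_ok; have [|//|d d_ok] := @computable_comp n.+2
    (fun w => P (var 0 w) (behead w)) (var 0 :: [seq var i | i <- iota 2 n]).
- by rewrite /= size_map size_iota; exists c.
- by constructor; [|elim: (iota 2 n) => [|i s IH]; constructor=> //]; exact: computable_var.
exists d => -[//|k [//|r v]] [sv]; have := d_ok [:: k, r & v].
by rewrite /= -{1 2}sv (map_vars [:: k; r]) => /(_ erefl).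
Qed.

Lemma computable_has n N (P : nat -> seq nat -> bool) :
  computable n N -> computable n.+1 (fun w => P (var 0 w) (behead w)) ->
  computable n (fun v => has (fun k => P k v) (iota 0 (N v))).
Proof.
move=> cN cP; apply: (@computable_ext _ (fun v => ~~ all (fun k => ~~ P k v) (iota 0 (N v)))).
  move=> v _; rewrite -has_predC; congr (nat_of_bool _).
  by apply: eq_has => k /=; rewrite negbK.
by apply: computable_negb; apply: (@computable_all _ _ (fun k v => ~~ P k v));
  last apply: computable_negb.
Qed.

Ltac computability_rule ::=
  first
  [ simple apply computable_andb | simple apply computable_orb
  | simple apply computable_negb | simple apply computable_eqn
  | simple apply computable_if
  | simple apply computable_iter
  | apply computable_all | apply computable_has ].

Lemma recursive2_pair : recursive2 cpair.
Proof.
apply/recursive2P; apply: (@computable_ext _ (fun v =>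
    var 1 v + iteri (var 1 v + var 0 v) (fun m r => m.+1 + r) 0)).
  by move=> v _; rewrite /cpair /=; congr (_ + _); rewrite plusE; elim: (_ + _) => //= m ->.
apply: computable_app2; try computability.
by apply: (@computable_rec _ _ _ (fun m r _ => m.+1 + r)); computability.
Qed.
#[local] Hint Resolve recursive2_pair : computability.

(** Minimisation turns a decidable graph into a function: to compute f it is
    enough to recognise its values. *)
Lemma computable_min n f (D : nat -> seq nat -> bool) :
  (forall v k, size v = n -> D k v = (k == f v)) ->
  computable n.+1 (fun w => D (var 0 w) (behead w)) -> computable n f.
Proof.
move=> Df cD; have [d d_ok] := computable_negb cD.
exists (Min d) => v sv; apply/computes_Min; split=> [|k lt].
  by have := d_ok (f v :: v); rewrite /= sv Df // eqxx /=; exact.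
by exists 0; have := d_ok (k :: v); rewrite /= sv Df // (ltn_eqF lt) /=; exact.
Qed.

Definition unpair1 n := (Cantor.of_nat n).1.
Definition unpair2 n := (Cantor.of_nat n).2.

Lemma pairK n : <<unpair1 n, unpair2 n>> = n.
Proof. by rewrite /unpair1 /unpair2 /cpair -surjective_pairing Cantor.cancel_to_of. Qed.

Lemma unpair1K x y : unpair1 <<x, y>> = x.
Proof. by rewrite /unpair1 /cpair Cantor.cancel_of_to. Qed.

Lemma unpair2K x y : unpair2 <<x, y>> = y.
Proof. by rewrite /unpair2 /cpair Cantor.cancel_of_to. Qed.

Lemma pair_ge x y : (x <= <<x, y>>) && (y <= <<x, y>>).
Proof. by have := Cantor.to_nat_non_decreasing x y; rewrite /cpair; lia. Qed.

Lemma unpair_le n : (unpair1 n <= n) && (unpair2 n <= n).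
Proof. by rewrite -{2 4}[n]pairK pair_ge. Qed.

Lemma pair_inj x y x' y' : <<x, y>> = <<x', y'>> -> x = x' /\ y = y'.
Proof. by move=> /Cantor.to_nat_inj[-> ->]. Qed.

Lemma recursive1_unpair1 : recursive1 unpair1.
Proof.
apply/recursive1P.
apply: (@computable_min _ _ (fun k v =>
  has (fun j => <<k, j>> == var 0 v) (iota 0 (var 0 v).+1))); last by computability.
move=> v k _; apply/hasP/eqP=> [[j _ /eqP<-]|->]; first by rewrite unpair1K.
exists (unpair2 (var 0 v)); last by rewrite pairK.
by rewrite mem_iota ltnS; case/andP: (unpair_le (var 0 v)).
Qed.

Lemma recursive1_unpair2 : recursive1 unpair2.
Proof.
apply/recursive1P.
apply: (@computable_min _ _ (fun k v =>
  has (fun j => <<j, k>> == var 0 v) (iota 0 (var 0 v).+1))); last by computability.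
move=> v k _; apply/hasP/eqP=> [[j _ /eqP<-]|->]; first by rewrite unpair2K.
exists (unpair1 (var 0 v)); last by rewrite pairK.
by rewrite mem_iota ltnS; case/andP: (unpair_le (var 0 v)).
Qed.
#[local] Hint Resolve recursive1_unpair1 recursive1_unpair2 : computability.

(** * Coded lists *)

(** The list coding used by [goedel] for the arguments of [Comp]; every number
    codes exactly one list. *)
Definition code : seq nat -> nat := foldr (fun x n => <<x, n>>.+1) 0.
Definition ccons x n := <<x, n>>.+1.

(** As 0 = <<0, 0>>, the conventions for the empty list agree with those of
    [head] and [behead]: its head is 0 and its tail is empty. *)
Definition chead n := unpair1 n.-1.
Definition ctail n := unpair2 n.-1.
Definition cnth n i := chead (iter i ctail n).

Lemma chead_code l : chead (code l) = head 0 l.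
Proof. by case: l => // x l; exact: unpair1K. Qed.

Lemma ctail_code l : ctail (code l) = code (behead l).
Proof. by case: l => // x l; exact: unpair2K. Qed.

Lemma cnth_code l i : cnth (code l) i = nth 0 l i.
Proof.
rewrite /cnth; elim: i l => [|i IH] l; first by rewrite /= chead_code nth0.
by rewrite iterSr ctail_code IH nth_behead.
Qed.

Lemma code_inj : injective code.
Proof.
by elim=> [|x l IH] [|y l'] //= [/pair_inj[-> /IH->]].
Qed.

Lemma code_surj n : exists l, code l = n.
Proof.
elim/ltn_ind: n => -[|n] IH; first by exists [::].
have [|l le] := IH (unpair2 n); first by have := unpair_le n; lia.
by exists (unpair1 n :: l); rewrite /= le pairK.
Qed.

Lemma size_le_code l : size l <= code l.
Proof.
elim: l => //= x l IH; rewrite ltnS; apply: leq_trans IH _.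
by case/andP: (pair_ge x (code l)).
Qed.

Lemma recursive2_ccons : recursive2 ccons.
Proof. by apply/recursive2P; rewrite /ccons; computability. Qed.

Lemma recursive1_chead : recursive1 chead.
Proof. by apply/recursive1P; rewrite /chead; computability. Qed.

Lemma recursive1_ctail : recursive1 ctail.
Proof. by apply/recursive1P; rewrite /ctail; computability. Qed.
#[local] Hint Resolve recursive2_ccons recursive1_chead recursive1_ctail : computability.

Lemma recursive2_cnth : recursive2 cnth.
Proof. by apply/recursive2P; rewrite /cnth; computability. Qed.
#[local] Hint Resolve recursive2_cnth : computability.

(** * Sets generated by two-premise rules *)

(** The number 0 is a dummy premise for the rules with fewer than two
    premises. *)
Inductive derivable (J : nat -> nat -> nat -> bool) : nat -> Prop :=
  | derivable0 : derivable J 0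
  | derivable_rule x a b :
      derivable J a -> derivable J b -> J x a b -> derivable J x.

(** A certificate codes a list in which every nonzero entry follows from two
    entries further down. Positions past the end hold 0, so the dummy premise is
    always available; positions up to p suffice since a list is never longer
    than its code. *)
Definition certificate (J : nat -> nat -> nat -> bool) p : bool :=
  all (fun k => (cnth p k == 0) ||
         has (fun i => has (fun j => J (cnth p k) (cnth p (k + i.+1)) (cnth p (k + j.+1)))
                         (iota 0 p.+1))
           (iota 0 p.+1))
    (iota 0 p).

Lemma recursive1_certificate J :
  recursive3 (fun x a b => J x a b : bool) -> recursive1 (fun p => certificate J p : bool).
Proof.
move=> rJ; apply/recursive1P; rewrite /certificate.
by computability.
Qed.

(** Premises stand at larger positions, and from position p on there are only
    zeros: induction on the distance to p. *)
Lemma certificate_sound J p k : certificate J p -> derivable J (cnth p k).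
Proof.
have [l <-] := code_surj p; move=> /allP ok.
have [m le] := ubnP (code l - k); elim: m k le => // m IH k lt.
have [le|lt'] := leqP (code l) k.
  rewrite cnth_code nth_default; first exact: derivable0.
  exact: leq_trans (size_le_code l) le.
have /ok : k \in iota 0 (code l) by rewrite mem_iota.
case/orP=> [/eqP->|/hasP[i _ /hasP[j _]]]; first exact: derivable0.
by apply: derivable_rule; apply: IH; lia.
Qed.

(** The certificates as lists, before coding: membership instead of positions
    makes them stable under concatenation, hence closed under rules. *)
Fixpoint justified (J : nat -> nat -> nat -> bool) l :=
  if l is x :: l' then
    justified J l' && has (fun a => has (fun b => J x a b) (0 :: l')) (0 :: l')
  else true.

Lemma justified_cat J l l' : justified J l -> justified J l' -> justified J (l ++ l').
Proof.
elim: l => //= x l IH /andP[/IH{}IH Jx] /IH-> /=.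
have sub y : y \in 0 :: l -> y \in 0 :: l ++ l'.
  by rewrite !inE mem_cat => /orP[->|->]; rewrite ?orbT.
have /hasP[a /sub la /hasP[b /sub lb J_ab]] :
  has (fun a => has (J x a) (0 :: l)) (0 :: l) by [].
apply/(@hasP _ _ (0 :: l ++ l')); exists a => //.
by apply/(@hasP _ _ (0 :: l ++ l')); exists b.
Qed.

Lemma derivable_justified J x :
  derivable J x -> x <> 0 -> exists l, justified J (x :: l).
Proof.
have J_cons y a b l : justified J l -> a \in 0 :: l -> b \in 0 :: l -> J y a b ->
    justified J (y :: l).
  move=> Jl la lb J_ab; rewrite /= Jl; apply/(@hasP _ _ (0 :: l)); exists a => //.
  by apply/(@hasP _ _ (0 :: l)); exists b.
have der_list a : (a <> 0 -> exists l, justified J (a :: l)) ->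
    exists2 l, justified J l & a \in 0 :: l.
  have [->|/eqP a0 [//|l Jl]] := eqVneq a 0; first by exists [::].
  by exists (a :: l); rewrite // !inE eqxx orbT.
elim=> // {}x a b _ /der_list[l Jl la] _ /der_list[l' Jl' lb] J_ab _.
exists (l ++ l'); apply: J_cons J_ab; first exact: justified_cat.
  by move: la; rewrite !inE mem_cat => /orP[->|->]; rewrite ?orbT.
by move: lb; rewrite !inE mem_cat => /orP[->|->]; rewrite ?orbT.
Qed.

Lemma justified_certificate J l : justified J l -> certificate J (code l).
Proof.
move=> Jl; apply/allP=> k _; rewrite !cnth_code.
have [le|lt] := leqP (size l) k; first by rewrite nth_default.
apply/orP; right.
have idx a : a \in 0 :: drop k.+1 l ->
    exists2 i, i \in iota 0 (code l).+1 & cnth (code l) (k + i.+1) = a.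
  move=> la; exists (index a (rcons (drop k.+1 l) 0)).
    rewrite mem_iota /= ltnS; apply: leq_trans (size_le_code l).
    have: index a (rcons (drop k.+1 l) 0) < size (rcons (drop k.+1 l) 0).
      by rewrite index_mem mem_rcons.
    by rewrite size_rcons size_drop; lia.
  rewrite cnth_code -addSnnS -nth_drop.
  have := nth_index 0 (_ : a \in rcons (drop k.+1 l) 0).
  rewrite mem_rcons nth_rcons => /(_ la); case: ifP => // /negbT ge.
  by rewrite if_same => a0; rewrite nth_default // leqNgt.
have /idP : has (fun a => has (J (nth 0 l k) a) (0 :: drop k.+1 l)) (0 :: drop k.+1 l).
  elim: l k lt Jl {idx} => //= x l IH [|k]; first by rewrite drop0 => _ /andP[].
  by rewrite ltnS => lt /andP[Jl _]; exact: IH.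
case/hasP=> a /idx[i li <-] /hasP[b /idx[j lj <-] J_ab].
by apply/hasP; exists i => //; apply/hasP; exists j.
Qed.

Lemma derivable_certificate J x : x <> 0 ->
  derivable J x <-> exists2 p, certificate J p & cnth p 0 = x.
Proof.
move=> x0; split=> [der|[p ok <-]]; last exact: certificate_sound.
have [l Jl] := derivable_justified der x0.
by exists (code (x :: l)); [exact: justified_certificate | rewrite cnth_code].
Qed.

(** * The enumeration theorem *)

(** A fact of kind k about a number c, an input v and an output r, where v always
    codes a list of arguments:
    - kind 1: the term number c has value r at v;
    - kind 2: c codes a list of numbers of terms, whose values at v form the list
      coded by r;
    - kind 3: the term number c has a nonzero value at y :: v for each y < r;
    - kind 4: c is the number of a term;
    - kind 5: c codes a list of numbers of terms.
    Kinds 2 and 3 break up the rules for [Comp] and [Min], whose number of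
    premises varies. Kind 4 is needed for [Prec f g] at 0, where g is not run but
    must still be the number of a term. Kinds start at 1 because the dummy 0 has
    kind 0. *)
Definition fact k c v r := code [:: k; c; v; r].
Definition kind x := cnth x 0.
Definition subject x := cnth x 1.
Definition input x := cnth x 2.
Definition output x := cnth x 3.

Lemma factE k c v r :
  ((kind (fact k c v r) = k) * (subject (fact k c v r) = c) *
   (input (fact k c v r) = v) * (output (fact k c v r) = r))%type.
Proof. by rewrite /kind /subject /input /output /fact !cnth_code. Qed.

(** The disjuncts treat, in this order, the constructors [Zero], [Succ], [Proj],
    [Comp], [Prec] at 0, [Prec] at a successor, and [Min]. *)
Definition eval_rule x a b : bool :=
  (kind x == 1) &&
  [|| (subject x == <<0, 0>>) && (output x == 0),
      (subject x == <<1, 0>>) && (output x == (chead (input x)).+1),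
      (subject x == <<2, unpair2 (subject x)>>) &&
        (output x == cnth (input x) (unpair2 (subject x))),
      [&& kind a == 1, kind b == 2, subject x == <<3, <<subject a, subject b>>>>,
          input b == input x, input a == output b & output a == output x],
      [&& chead (input x) == 0, kind a == 1, kind b == 4,
          subject x == <<4, <<subject a, subject b>>>>,
          input a == ctail (input x) & output a == output x],
      [&& chead (input x) != 0, kind a == 1, kind b == 1,
          subject x == <<4, <<unpair1 (unpair2 (subject x)), subject b>>>>,
          subject a == subject x, input a == ccons (chead (input x)).-1 (ctail (input x)),
          input b == ccons (chead (input x)).-1 (ccons (output a) (ctail (input x)))
        & output b == output x]
    | [&& kind a == 3, kind b == 1, subject x == <<5, subject b>>, subject a == subject b,
          input a == input x, output a == output x, input b == ccons (output x) (input x)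
        & output b == 0]].

Definition eval_seq_rule x a b : bool :=
  (kind x == 2) &&
  ((subject x == 0) && (output x == 0) ||
   [&& kind a == 1, kind b == 2, subject x == ccons (subject a) (subject b),
       input a == input x, input b == input x & output x == ccons (output a) (output b)]).

Definition nonzero_below_rule x a b : bool :=
  (kind x == 3) &&
  ((output x == 0) ||
   [&& kind a == 3, kind b == 1, subject a == subject x, subject b == subject x,
       input a == input x, output x == (output a).+1, input b == ccons (output a) (input x)
     & output b != 0]).

Definition term_rule x a b : bool :=
  (kind x == 4) &&
  [|| subject x == <<0, 0>>, subject x == <<1, 0>>, subject x == <<2, unpair2 (subject x)>>,
      [&& kind a == 4, kind b == 5 & subject x == <<3, <<subject a, subject b>>>>],
      [&& kind a == 4, kind b == 4 & subject x == <<4, <<subject a, subject b>>>>]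
    | (kind a == 4) && (subject x == <<5, subject a>>)].

Definition term_seq_rule x a b : bool :=
  (kind x == 5) &&
  ((subject x == 0) ||
   [&& kind a == 4, kind b == 5 & subject x == ccons (subject a) (subject b)]).

Definition rule x a b : bool :=
  [|| eval_rule x a b, eval_seq_rule x a b, nonzero_below_rule x a b,
      term_rule x a b | term_seq_rule x a b].

Lemma recursive1_kind : recursive1 kind.
Proof. by apply/recursive1P; rewrite /kind; computability. Qed.

Lemma recursive1_subject : recursive1 subject.
Proof. by apply/recursive1P; rewrite /subject; computability. Qed.

Lemma recursive1_input : recursive1 input.
Proof. by apply/recursive1P; rewrite /input; computability. Qed.

Lemma recursive1_output : recursive1 output.
Proof. by apply/recursive1P; rewrite /output; computability. Qed.
#[local] Hint Resolve recursive1_kind recursive1_subject : computability.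
#[local] Hint Resolve recursive1_input recursive1_output : computability.

Lemma recursive3_rule : recursive3 (fun x a b => rule x a b : bool).
Proof.
apply/recursive3P; rewrite /rule.
repeat apply: computable_orb.
- by rewrite /eval_rule; computability.
- by rewrite /eval_seq_rule; computability.
- by rewrite /nonzero_below_rule; computability.
- by rewrite /term_rule; computability.
- by rewrite /term_seq_rule; computability.
Qed.
#[local] Hint Resolve recursive3_rule : computability.

Lemma goedelE :
  ((goedel Zero = <<0, 0>>) * (goedel Succ = <<1, 0>>) *
   (forall i, goedel (Proj i) = <<2, i>>) *
   (forall f gs, goedel (Comp f gs) = <<3, <<goedel f, code [seq goedel g | g <- gs]>>>>) *
   (forall f g, goedel (Prec f g) = <<4, <<goedel f, goedel g>>>>) *
   (forall f, goedel (Min f) = <<5, goedel f>>))%type.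
Proof. by do ![split] => // f gs; rewrite /= /code foldr_map. Qed.

Lemma goedel_inj : injective goedel.
Proof.
elim/recterm_nested_ind=> [||i|f gs IHf IHgs|f g IHf IHg|f IHf] [||i'|f' gs'|f' g'|f'];
  rewrite !goedelE => /pair_inj[] //.
- by move=> _ ->.
- move=> _ /pair_inj[/IHf-> /code_inj e]; congr Comp.
  by elim: IHgs gs' e => [|g {}gs gP _ IH] [|g' gs'] //= [/gP-> /IH->].
- by move=> _ /pair_inj[/IHf-> /IHg->].
- by move=> _ /IHf->.
Qed.

(** For kind 3 nothing is said about the subject when the output is 0: such a
    fact is derivable for any subject. *)
Definition sound_fact x : Prop :=
  match kind x with
  | 1 => exists t l, [/\ goedel t = subject x, code l = input x & computes t l (output x)]
  | 2 => exists ts l ws,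
      [/\ code [seq goedel t | t <- ts] = subject x, code l = input x, code ws = output x
        & List.Forall2 (fun t w => computes t l w) ts ws]
  | 3 => exists2 l, code l = input x & forall y, y < output x ->
      exists t q, goedel t = subject x /\ computes t (y :: l) q.+1
  | 4 => exists t, goedel t = subject x
  | 5 => exists ts, code [seq goedel t | t <- ts] = subject x
  | _ => True
  end.

Lemma eval_rule_sound x a b :
  sound_fact a -> sound_fact b -> eval_rule x a b -> sound_fact x.
Proof.
move=> Ha Hb /andP[/eqP kx]; rewrite /sound_fact kx.
have [l lx] := code_surj (input x).
case/or4P=> [/andP[/eqP cx /eqP->]|/andP[/eqP cx /eqP->]|/andP[/eqP cx /eqP->]|].
- by exists Zero, l; split=> //; exact: computes_Zero.
- exists Succ, l; split=> //.
  by rewrite -lx chead_code; exact: computes_Succ.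
- exists (Proj (unpair2 (subject x))), l; split=> //.
  by rewrite -lx cnth_code; exact: computes_Proj.
case/or4P.
- case/and5P=> /eqP ka /eqP kb /eqP cx /eqP vb /andP[/eqP va /eqP ra].
  move: Ha Hb; rewrite /sound_fact ka kb.
  move=> [t [ws [ta wsa tws]]] [ts [l' [ws' [tsb lb wsb tsl]]]].
  have ? : l' = l by apply: code_inj; rewrite lb vb lx.
  have ? : ws' = ws by apply: code_inj; rewrite wsb wsa va.
  subst l' ws'; exists (Comp t ts), l; split=> //.
    by rewrite goedelE cx ta tsb.
  by rewrite -ra; apply/computes_Comp; exists ws.
- case/and5P=> /eqP vx /eqP ka /eqP kb /eqP cx /andP[/eqP va /eqP ra].
  move: Ha Hb; rewrite /sound_fact ka kb => -[f [w [fa wa fw]]] [g gb].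
  exists (Prec f g), l; split=> //; first by rewrite goedelE cx fa gb.
  apply: computes_Prec0; first by rewrite -chead_code lx.
  suff <- : w = behead l by rewrite -ra.
  by apply: code_inj; rewrite wa va -lx ctail_code.
- case/and5P=> vx /eqP ka /eqP kb /eqP cx /and4P[/eqP ca /eqP va /eqP vb /eqP rb].
  move: Ha Hb; rewrite /sound_fact ka kb => -[t [w [ta wa tw]]] [g [u [gb ub gu]]].
  move: ta; rewrite ca cx; case: t tw => [||i|f gs|f g'|f] tw;
    rewrite goedelE => /pair_inj[] // _ /pair_inj[fE]; rewrite -gb => /goedel_inj ?; subst g'.
  exists (Prec f g), l; split=> //; first by rewrite goedelE fE gb -cx.
  have vm : head 0 l = (chead (input x)).-1.+1 by rewrite prednK ?lt0n // -chead_code lx.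
  set m := (chead (input x)).-1 in va vb vm.
  have wE : w = m :: behead l.
    by apply: code_inj; rewrite wa va -lx ctail_code.
  have uE : u = [:: m, output a & behead l].
    by apply: code_inj; rewrite ub vb -lx ctail_code.
  by apply: (computes_PrecS vm (q := output a)); rewrite -?wE // -uE -rb.
- case/and5P=> /eqP ka /eqP kb /eqP cx /eqP ca /and4P[/eqP va /eqP ra /eqP vb /eqP rb].
  move: Ha Hb; rewrite /sound_fact ka kb => -[w wa pos] [f [u [fb ub fu]]].
  exists (Min f), l; split=> //; first by rewrite goedelE cx fb.
  have wE : w = l by apply: code_inj; rewrite wa va.
  have uE : u = output x :: l by apply: code_inj; rewrite ub vb -lx.
  apply/computes_Min; rewrite -uE -rb; split=> // y; rewrite -ra => /pos[t [q []]].
  by rewrite ca -fb wE => /goedel_inj-> ?; exists q.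
Qed.

Lemma eval_seq_rule_sound x a b :
  sound_fact a -> sound_fact b -> eval_seq_rule x a b -> sound_fact x.
Proof.
move=> Ha Hb /andP[/eqP kx]; rewrite /sound_fact kx.
have [l lx] := code_surj (input x).
case/orP=> [/andP[/eqP-> /eqP->]|].
  by exists [::], l, [::]; split=> //; constructor.
case/and5P=> /eqP ka /eqP kb /eqP cx /eqP va /andP[/eqP vb /eqP rx].
move: Ha Hb; rewrite /sound_fact ka kb.
move=> [t [l' [ta la tl]]] [ts [l'' [ws [tsb lb wsb tsl]]]].
have ? : l' = l by apply: code_inj; rewrite la va.
have ? : l'' = l by apply: code_inj; rewrite lb vb.
subst l' l''; exists (t :: ts), l, (output a :: ws); split=> //.
- by rewrite cx -ta -tsb.
- by rewrite rx -wsb.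
- by constructor.
Qed.

Lemma nonzero_below_rule_sound x a b :
  sound_fact a -> sound_fact b -> nonzero_below_rule x a b -> sound_fact x.
Proof.
move=> Ha Hb /andP[/eqP kx]; rewrite /sound_fact kx.
have [l lx] := code_surj (input x).
case/orP=> [/eqP->|]; first by exists l.
case/and5P=> /eqP ka /eqP kb /eqP ca /eqP cb /and4P[/eqP va /eqP rx /eqP vb rb].
move: Ha Hb; rewrite /sound_fact ka kb => -[l' la pos] [t [u [tb ub tu]]].
have ? : l' = l by apply: code_inj; rewrite la va.
have uE : u = output a :: l by apply: code_inj; rewrite ub vb -lx.
subst l'; exists l => // y; rewrite rx ltnS leq_eqVlt => /orP[/eqP->|/pos].
  by exists t, (output b).-1; rewrite prednK ?lt0n // -uE tb cb.
by rewrite ca.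
Qed.

Lemma term_rule_sound x a b :
  sound_fact a -> sound_fact b -> term_rule x a b -> sound_fact x.
Proof.
move=> Ha Hb /andP[/eqP kx]; rewrite /sound_fact kx.
case/or4P=> [/eqP->|/eqP->|/eqP->|/or3P[]].
- by exists Zero.
- by exists Succ.
- by exists (Proj (unpair2 (subject x))).
- case/and3P=> /eqP ka /eqP kb /eqP->; move: Ha Hb; rewrite /sound_fact ka kb.
  by case=> f fa [gs gsb]; exists (Comp f gs); rewrite goedelE fa gsb.
- case/and3P=> /eqP ka /eqP kb /eqP->; move: Ha Hb; rewrite /sound_fact ka kb.
  by case=> f fa [g gb]; exists (Prec f g); rewrite goedelE fa gb.
- case/andP=> /eqP ka /eqP->; move: Ha; rewrite /sound_fact ka.
  by case=> f fa; exists (Min f); rewrite goedelE fa.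
Qed.

Lemma term_seq_rule_sound x a b :
  sound_fact a -> sound_fact b -> term_seq_rule x a b -> sound_fact x.
Proof.
move=> Ha Hb /andP[/eqP kx]; rewrite /sound_fact kx.
case/orP=> [/eqP->|]; first by exists [::].
case/and3P=> /eqP ka /eqP kb /eqP->; move: Ha Hb; rewrite /sound_fact ka kb.
by case=> t ta [ts tsb]; exists (t :: ts); rewrite /= ta tsb.
Qed.

Lemma derivable_sound x : derivable rule x -> sound_fact x.
Proof.
elim=> {x} [|x a b _ Ha _ Hb]; first by rewrite /sound_fact.
case/or4P=> [|||/orP[]].
- exact: eval_rule_sound.
- exact: eval_seq_rule_sound.
- exact: nonzero_below_rule_sound.
- exact: term_rule_sound.
- exact: term_seq_rule_sound.
Qed.

Lemma derivable_is_term t : derivable rule (fact 4 (goedel t) 0 0).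
Proof.
elim/recterm_nested_ind: t => [||i|f gs IHf IHgs|f g IHf IHg|f IHf].
- by apply: derivable_rule; try exact: derivable0;
  rewrite /rule /term_rule !factE !goedelE !eqxx !orbT.
- by apply: derivable_rule; try exact: derivable0;
  rewrite /rule /term_rule !factE !goedelE !eqxx !orbT.
- by apply: derivable_rule; try exact: derivable0;
  rewrite /rule /term_rule !factE !goedelE unpair2K !eqxx !orbT.
- have Dgs : derivable rule (fact 5 (code [seq goedel g | g <- gs]) 0 0).
    elim: IHgs => [|g {}gs Dg _ Dgs].
      by apply: derivable_rule; try exact: derivable0;
      rewrite /rule /term_seq_rule !factE !eqxx !orbT.
    by apply: derivable_rule Dg Dgs _; rewrite /rule /term_seq_rule !factE !eqxx !orbT.
  by apply: derivable_rule IHf Dgs _; rewrite /rule /term_rule !factE !goedelE !eqxx !orbT.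
- by apply: derivable_rule IHf IHg _; rewrite /rule /term_rule !factE !goedelE !eqxx !orbT.
- by apply: derivable_rule IHf (derivable0 _) _;
  rewrite /rule /term_rule !factE !goedelE !eqxx !orbT.
Qed.

(** Induction on the bound of [run]: each clause of the evaluator is one of the
    rules, and the inner inductions build the facts of kinds 2 and 3. *)
Lemma derivable_eval s t v r :
  run s t v = Some r -> derivable rule (fact 1 (goedel t) (code v) r).
Proof.
elim: s t v r => // s IH t v r; case: t => [||i|f gs|f g|f]; rewrite !goedelE /=.
- case=> <-; apply: derivable_rule; try exact: derivable0.
  by rewrite /rule /eval_rule !factE !eqxx.
- case=> <-; apply: derivable_rule; try exact: derivable0.
  by rewrite /rule /eval_rule !factE chead_code !eqxx !orbT.
- case=> <-; apply: derivable_rule; try exact: derivable0.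
  by rewrite /rule /eval_rule !factE unpair2K cnth_code !eqxx !orbT.
- case E: all_some => [ws|] //= /IH Df.
  have Dgs : derivable rule (fact 2 (code [seq goedel g | g <- gs]) (code v) (code ws)).
    move/all_someP: E; elim: gs ws {Df} => [|g gs IHgs] [|w ws] //=.
      move=> _; apply: derivable_rule; try exact: derivable0.
      by rewrite /rule /eval_seq_rule !factE !eqxx !orbT.
    case=> /IH Dg /IHgs Dgs; apply: derivable_rule Dg Dgs _.
    by rewrite /rule /eval_seq_rule !factE !eqxx !orbT.
  apply: derivable_rule Df Dgs _.
  by rewrite /rule /eval_rule !factE !eqxx !orbT.
- case v0 : (head 0 v) => [|m].
    move/IH=> Df; apply: derivable_rule Df (derivable_is_term g) _.
    by rewrite /rule /eval_rule !factE chead_code v0 ctail_code !eqxx !orbT.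
  case E: (run s (Prec f g) _) => [q|] //= /IH Dg.
  apply: derivable_rule (IH _ _ _ E) Dg _.
  rewrite /rule /eval_rule !factE chead_code v0 ctail_code unpair2K unpair1K.
  by rewrite !eqxx !orbT.
- move/searchP=> [_ /IH Df pos].
  have Dpos : derivable rule (fact 3 (goedel f) (code v) r).
    elim: r pos {Df} => [|r IHr] pos.
      apply: derivable_rule; try exact: derivable0.
      by rewrite /rule /nonzero_below_rule !factE !eqxx !orbT.
    have [|q /IH Dq] := pos r; first by lia.
    have Dr := IHr (fun y lt => pos y ltac:(lia)).
    apply: derivable_rule Dr Dq _.
    by rewrite /rule /nonzero_below_rule !factE !eqxx !orbT.
  apply: derivable_rule Dpos Df _.
  by rewrite /rule /eval_rule !factE !eqxx !orbT.
Qed.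

(** Kleene's predicate T in decidable form. The output of the fact proved by p is
    left free, because only halting matters. *)
Definition halting_witness e v p : bool :=
  [&& certificate rule p, kind (cnth p 0) == 1, subject (cnth p 0) == e
    & input (cnth p 0) == v].

Lemma recursive3_halting_witness :
  recursive3 (fun e v p => halting_witness e v p : bool).
Proof.
have cert := recursive1_certificate recursive3_rule.
by apply/recursive3P; rewrite /halting_witness; computability.
Qed.
#[local] Hint Resolve recursive3_halting_witness : computability.

(** The enumeration theorem: soundness of the rules gives one direction and their
    completeness the other. *)
Lemma halting_witnessP e v :
  (exists y, kleeneT e v y) <-> exists p, halting_witness e (code v) p.
Proof.
split=> [[y [t <-]]|[p /and4P[ok /eqP k1 /eqP <- /eqP av]]].
  case E: (run y t v) => [r|] // _.
  have fact0 : fact 1 (goedel t) (code v) r <> 0 by [].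
  have [p ok p0] := (derivable_certificate rule fact0).1 (derivable_eval E).
  by exists p; rewrite /halting_witness p0 !factE ok !eqxx.
have := derivable_sound (certificate_sound 0 ok).
rewrite /sound_fact k1 => -[t [l [tE lE [s tl]]]].
have <- : l = v by apply: code_inj; rewrite lE.
by exists s, t => //; rewrite tl.
Qed.

Definition halts c v := exists r, computes c v r.

Lemma kleeneT_goedel c v : (exists y, kleeneT (goedel c) v y) <-> halts c v.
Proof.
split=> [[y [t /goedel_inj->]]|[r [s cr]]].
  by case E: run => [r|] // _; exists r, y.
by exists s, c => //; rewrite cr.
Qed.

Lemma W_goedel c : W (goedel c) = [set x | halts c [:: x]]%classic.
Proof. by apply/seteqP; split=> x /kleeneT_goedel. Qed.

(** The n-ary RE relations in the form in which they occur below, as projections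
    of computable relations. *)
Definition semidecidable n (P : seq nat -> Prop) :=
  exists2 D : nat -> seq nat -> bool,
    computable n.+1 (fun w => D (var 0 w) (behead w)) &
    forall v, size v = n -> P v <-> exists p, D p v.

(** Search for the least p: for total d, [Min d] halts exactly when d has a zero. *)
Lemma semidecidable_halts n P : semidecidable n P ->
  exists c, forall v, size v = n -> P v <-> halts c v.
Proof.
case=> D cD PD; have [d d_ok] := computable_negb cD.
exists (Min d) => v sv; rewrite PD //.
have {}d_ok p : computes d (p :: v) (~~ D p v) by apply: (d_ok (p :: v)); rewrite /= sv.
split=> [ex|[r /computes_Min[d0 _]]].
  exists (ex_minn ex); case: ex_minnP => p Dp min_p.
  apply/computes_Min; split=> [|y lt]; first by have := d_ok p; rewrite Dp.
  exists 0; have := d_ok y; case Dy: (D y v) => //.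
  by have := min_p _ Dy; rewrite leqNgt lt.
by exists r; have := computes_det (d_ok r) d0; case: (D r v).
Qed.

(** * The strong double recursion theorem *)

Fixpoint const_term k := if k is k'.+1 then Comp Succ [:: const_term k'] else Zero.

Lemma computes_const_term k v : computes (const_term k) v k.
Proof.
elim: k => [|k IH] /=; first exact: computes_Zero.
apply/computes_Comp; exists [:: k]; last exact: computes_Succ.
by constructor.
Qed.

Definition goedel_const k := goedel (const_term k).

Lemma recursive1_goedel_const : recursive1 goedel_const.
Proof.
apply/recursive1P; apply: (@computable_ext _ (fun v =>
  iter (var 0 v) (fun n => <<3, <<<<1, 0>>, <<n, 0>>.+1>>>>) <<0, 0>>)).
  by move=> v _; rewrite /goedel_const; elim: (var 0 v) => //= k ->.
by computability.
Qed.
#[local] Hint Resolve recursive1_goedel_const : computability.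

(** The number of the term x |-> e(x, ks), written directly on numbers so that
    it is computable from e and ks; <<2, 0>> is the number of [Proj 0]. *)
Definition specialize e (ks : seq nat) :=
  <<3, <<e, ccons <<2, 0>> (code [seq goedel_const k | k <- ks])>>>>.

Lemma computes_specialize x ks :
  List.Forall2 (fun g w => computes g [:: x] w) (Proj 0 :: map const_term ks) (x :: ks).
Proof.
constructor; first exact: computes_Proj.
by elim: ks => [|k ks IH]; constructor=> //; exact: computes_const_term.
Qed.

Lemma W_specialize c ks : W (specialize (goedel c) ks) = [set x | halts c (x :: ks)]%classic.
Proof.
have -> : specialize (goedel c) ks = goedel (Comp c (Proj 0 :: map const_term ks)).
  by rewrite goedelE /= -map_comp.
rewrite W_goedel; apply/seteqP; split=> x [r].
  have gs_ok := computes_specialize x ks.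
  by case/computes_Comp=> ws gsws cr; exists r; rewrite -(computes_all_det gsws gs_ok).
by move=> cr; exists r; apply/computes_Comp; exists (x :: ks) => //;
  exact: computes_specialize.
Qed.

(** Diagonalisation: R1 and R2 are run at the indices obtained by specialising
    a and b to the parameters i, j and to a and b themselves. Taking for a and b
    the numbers of the two terms so defined, those indices become the indices of
    the very sets being enumerated. *)
Lemma double_recursion (R1 R2 : nat -> nat -> nat -> nat -> nat -> Prop) :
  semidecidable 5 (fun v => R1 (var 0 v) (var 1 v) (var 2 v) (var 3 v) (var 4 v)) ->
  semidecidable 5 (fun v => R2 (var 0 v) (var 1 v) (var 2 v) (var 3 v) (var 4 v)) ->
  exists t1 t2, [/\ recursive2 t1, recursive2 t2 & forall i j,
    W (t1 i j) = [set x | R1 x i j (t1 i j) (t2 i j)]%classic /\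
    W (t2 i j) = [set x | R2 x i j (t1 i j) (t2 i j)]%classic].
Proof.
move=> [D1 cD1 D1P] [D2 cD2 D2P].
pose t e i j a b := specialize e [:: i; j; a; b].
have ct n e i j a b : computable n e -> computable n i -> computable n j ->
    computable n a -> computable n b ->
    computable n (fun v => t (e v) (i v) (j v) (a v) (b v)).
  move=> ce ci cj ca cb; rewrite /t /specialize /= -!/(ccons _ _).
  by computability.
(* The variables of v are x, i, j, a, b. *)
pose diagonal v := [:: var 0 v; var 1 v; var 2 v;
  t (var 3 v) (var 1 v) (var 2 v) (var 3 v) (var 4 v);
  t (var 4 v) (var 1 v) (var 2 v) (var 3 v) (var 4 v)].
have diag D : computable 6 (fun w => D (var 0 w) (behead w) : bool) ->
    semidecidable 5 (fun v => exists p, D p (diagonal v)).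
  move=> cD; exists (fun p v => D p (diagonal v)) => //.
  pose u e (w : seq nat) := t (var e w) (var 2 w) (var 3 w) (var 4 w) (var 5 w).
  have cu e : computable 6 (u e) by apply: ct; computability.
  apply: (@computable_ext _ (fun w => nat_of_bool (D (var 0 w)
    [:: var 1 w; var 2 w; var 3 w; u 4 w; u 5 w]))).
    by case=> [//|p [|x [|y [|z [|a [|b [|//]]]]]]].
  apply: (@computable_comp 6 (fun w => D (var 0 w) (behead w) : nat)
    [:: var 0; var 1; var 2; var 3; u 4; u 5]) => //.
  by do 6![apply: List.Forall_cons; first by [exact: computable_var | exact: cu]].
have [c1 c1P] := semidecidable_halts (diag D1 cD1).
have [c2 c2P] := semidecidable_halts (diag D2 cD2).
exists (fun i j => t (goedel c1) i j (goedel c1) (goedel c2)).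
exists (fun i j => t (goedel c2) i j (goedel c1) (goedel c2)).
split; [apply/recursive2P; apply: ct; computability .. |].
move=> i j; rewrite !W_specialize; split; apply/seteqP; split=> x /=.
- by move/c1P=> /(_ erefl) /D1P; apply.
- by move=> R; apply/c1P => //; apply/D1P.
- by move/c2P=> /(_ erefl) /D2P; apply.
- by move=> R; apply/c2P => //; apply/D2P.
Qed.

(** * Comparing stages of enumerations *)

Lemma W_witness e x : W e x <-> exists p, halting_witness e (ccons x 0) p.
Proof. exact: halting_witnessP e [:: x]. Qed.

(** Strictness makes the comparison asymmetric, so the two sets that it defines
    are disjoint even where both terms halt at the same stage. *)
Definition halts_first e e' v p : bool :=
  halting_witness e v p && all (fun q => ~~ halting_witness e' v q) (iota 0 p.+1).

Lemma computable_halts_first e e' v p n :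
  computable n e -> computable n e' -> computable n v -> computable n p ->
  computable n (fun w => halts_first (e w) (e' w) (v w) (p w)).
Proof. by move=> *; rewrite /halts_first; computability. Qed.

Lemma halts_first_asym e e' v p q : halts_first e e' v p -> ~~ halts_first e' e v q.
Proof.
move=> /andP[hp /allP e'p]; apply/negP=> /andP[hq /allP eq].
have [le|lt] := leqP p q.
  by have /eq : p \in iota 0 q.+1; [rewrite mem_iota; lia | rewrite hp].
by have /e'p : q \in iota 0 p.+1; [rewrite mem_iota; lia | rewrite hq].
Qed.

Lemma halts_first_exists e e' v :
  (exists p, halting_witness e v p) -> ~ (exists p, halting_witness e' v p) ->
  exists p, halts_first e e' v p.
Proof.
move=> [p hp] no; exists p; rewrite /halts_first hp.
by apply/allP=> q _; apply/negP=> hq; apply: no; exists q.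
Qed.

Lemma RE_semidecidable (P : nat -> Prop) :
  semidecidable 1 (fun v => P (var 0 v)) -> RE [set x | P x]%classic.
Proof.
move=> /semidecidable_halts[c cP]; exists (goedel c).
by rewrite W_goedel; apply/seteqP; split=> x /=;
  have := cP [:: x] erefl; rewrite /var /= => ->.
Qed.

Lemma RE2_semidecidable (M : nat -> nat -> Prop) :
  semidecidable 2 (fun v => M (var 0 v) (var 1 v)) -> RE2 M.
Proof.
move=> /semidecidable_halts[c cM]; exists (goedel c) => x y.
by rewrite kleeneT_goedel; exact: cM [:: x; y] erefl.
Qed.

Local Open Scope classical_set_scope.

Lemma disjointP (X Y : set nat) :
  X `&` Y = set0 <-> forall x, X x -> Y x -> False.
Proof.
split=> [XY x Xx Yx|XY]; first by rewrite -[False]/(set0 x) -XY.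
by apply/seteqP; split=> // x [/XY].
Qed.

(** * The implications *)

Lemma KP_CEI A B : KP A B -> CEI A B.
Proof.
case=> f rf fP; exists f => // i j Ai Bj; have [fA fB] := fP i j.
split=> [Wi|Wj]; apply: contrapT => no.
  by apply/no/Bj/fB; split.
by apply/no/Ai/fA; split.
Qed.

Lemma CEI_EI A B : CEI A B -> EI A B.
Proof.
case=> f rf fP; exists f => // i j Ai Bj /disjointP Wij.
by case=> ?; apply: (Wij (f i j)) => //; apply/(fP i j Ai Bj).
Qed.

(** If z = f(i, j) violated one of the last two clauses of WEI, then W_i and W_j
    would still be disjoint and EI would exclude z from them, although z was just
    added to one. *)
Lemma EI_WEI A B : A `&` B = set0 -> EI A B -> WEI A B.
Proof.
move=> AB; have /disjointP dis := AB; case=> f rf fP; exists f => // i j.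
split=> Wi Wj.
- by rewrite -Wi -Wj; apply: fP; rewrite ?Wi ?Wj.
- apply: contrapT => no; apply: (fP i j); rewrite ?Wi ?Wj //; last by right; right.
  by apply/disjointP=> x Ax [Bx|/= xf]; [exact: dis Ax Bx | apply: no; rewrite -xf].
- apply: contrapT => no; apply: (fP i j); rewrite ?Wi ?Wj //; last by left; right.
  by apply/disjointP=> x [Ax|/= ->]; [exact: dis Ax | exact: no].
Qed.

(** By double recursion z can be added to A when it lies in W_j, and to B when it
    lies in W_i. The roles are crossed because WEI puts z into A when it is the
    set for B that has grown. *)
Lemma WEI_DG A B : RE A -> RE B -> A `&` B = set0 -> WEI A B -> DG A B.
Proof.
move=> [a ->] [b ->] /disjointP AB [f rf fP].
have semi e k : semidecidable 5 (fun v => W e (var 0 v) \/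
    var 0 v = f (var 3 v) (var 4 v) /\ W (var k v) (var 0 v)).
  exists (fun p v => halting_witness e (ccons (var 0 v) 0) p ||
    (var 0 v == f (var 3 v) (var 4 v)) && halting_witness (var k v) (ccons (var 0 v) 0) p).
    by computability.
  move=> v _; rewrite !W_witness.
  split=> [[[p hp]|[/eqP xf [p hp]]]|[p /orP[hp|/andP[/eqP xf hp]]]].
  - by exists p; rewrite hp.
  - by exists p; rewrite xf hp orbT.
  - by left; exists p.
  - by right; split=> //; exists p.
have [t1 [t2 [rt1 rt2 tP]]] := @double_recursion
  (fun x i j s t => W a x \/ x = f s t /\ W j x)
  (fun x i j s t => W b x \/ x = f s t /\ W i x) (semi a 2) (semi b 1).
exists (fun i j => f (t1 i j) (t2 i j)); first by computability.
move=> i j /disjointP Wij; have [] := tP i j; have [] := fP (t1 i j) (t2 i j).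
set z := f _ _ => none inA inB W1 W2.
have W1a : ~ W j z -> W (t1 i j) = W a.
  by move=> jz; rewrite W1; apply/seteqP; split=> x /=; [case=> [|[->]]|left].
have W2b : ~ W i z -> W (t2 i j) = W b.
  by move=> iz; rewrite W2; apply/seteqP; split=> x /=; [case=> [|[->]]|left].
have W1z : W j z -> W (t1 i j) = W a `|` [set z].
  move=> jz; rewrite W1; apply/seteqP; split=> x /= [];
    [by left | by case=> -> _; right | by left | by move=> ->; right].
have W2z : W i z -> W (t2 i j) = W b `|` [set z].
  move=> iz; rewrite W2; apply/seteqP; split=> x /= [];
    [by left | by case=> -> _; right | by left | by move=> ->; right].
have zA : W i z -> W a z.
  move=> iz; apply: inA; last exact: W2z.
  by apply: W1a => jz; exact: Wij iz jz.
have zB : W j z -> W b z.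
  move=> jz; apply: inB; first exact: W1z.
  by apply: W2b => iz; exact: Wij iz jz.
have out : ~ W i z -> ~ W j z -> ~ (W a `|` W b) z.
  by move=> /W2b W2' /W1a W1'; exact: none.
split; split=> //.
- move=> az; apply: contrapT => iz; apply: (out iz); last by left.
  by move=> /zB; exact: AB az.
- move=> bz; apply: contrapT => jz; apply: (out _ jz); last by right.
  by move=> /zA az; exact: AB az bz.
Qed.

Lemma DG_DCP A B : DG A B -> DCP A B.
Proof.
case=> f rf fP; exists f => // i j dij /disjointP iA /disjointP jB.
have [Ai Bj] := fP i j dij.
case=> [[[Af|Bf]|Wi]|Wj].
- by apply: (iA (f i j)); rewrite -?Ai.
- by apply: (jB (f i j)); rewrite -?Bj.
- by apply: (iA (f i j)) => //; exact/Ai.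
- by apply: (jB (f i j)) => //; exact/Bj.
Qed.

Lemma DCP_WDCP A B : DCP A B -> WDCP A B.
Proof.
case=> f rf fP; exists f => // i j; have := fP i j.
split=> Wi Wj.
- by move=> AB; apply: (fP i j); rewrite ?Wi ?Wj ?set0I //; left; left.
- apply: contrapT => nB; apply: (fP i j); rewrite ?Wi ?Wj ?set0I //; last by right.
  by apply/disjointP => x /= ->.
- apply: contrapT => nA; apply: (fP i j); rewrite ?Wi ?Wj ?set0I ?setI0 //;
    last by left; right.
  by apply/disjointP => x /= ->.
Qed.

(** Double recursion makes the first set {z} or empty according to whether x is
    in A', and the second likewise for B'; WDCP then decides the side of z.
    The sets have the single parameter x, so the other one is fixed at 0. *)
Lemma WDCP_DU A B : A `&` B = set0 -> WDCP A B -> DU A B.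
Proof.
move=> /disjointP AB [f rf fP] _ _ [a ->] [b ->] /disjointP ab.
have semi e : semidecidable 5 (fun v =>
    var 0 v = f (var 3 v) (var 4 v) /\ W e (var 1 v)).
  exists (fun p v => (var 0 v == f (var 3 v) (var 4 v)) &&
                     halting_witness e (ccons (var 1 v) 0) p).
    by computability.
  move=> v _; rewrite W_witness; split=> [[/eqP -> [p hp]]|[p /andP[/eqP-> hp]]].
    by exists p.
  by split=> //; exists p.
have [t1 [t2 [rt1 rt2 tP]]] := @double_recursion
  (fun x i _ s t => x = f s t /\ W a i) (fun x i _ s t => x = f s t /\ W b i)
  (semi a) (semi b).
exists (fun x => f (t1 x 0) (t2 x 0)); first by computability.
move=> x; have [] := tP x 0; have [] := fP (t1 x 0) (t2 x 0).
set z := f _ _ => none inB inA W1 W2.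
have out e (t : nat) : W t = [set y | y = z /\ W e x] -> ~ W e x -> W t = set0.
  by move=> -> no; apply/seteqP; split=> y // [].
have in_ e (t : nat) : W t = [set y | y = z /\ W e x] -> W e x -> W t = [set z].
  by move=> -> yes; apply/seteqP; split=> y //= [].
have zA : W a x -> A z.
  by move=> ax; apply: inA; [exact: in_ W1 ax | apply: out W2 _ => /(ab _ ax)].
have zB : W b x -> B z.
  by move=> bx; apply: inB; [apply: out W1 _ => /ab/(_ bx) | exact: in_ W2 bx].
have zAB : ~ W a x -> ~ W b x -> ~ (A `|` B) z.
  by move=> ax bx; apply: none; [exact: out W1 ax | exact: out W2 bx].
split; split=> //.
- move=> Az; apply: contrapT => ax; apply: (zAB ax); last by left.
  by move=> /zB; exact: AB Az.
- move=> Bz; apply: contrapT => bx; apply: (zAB _ bx); last by right.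
  by move=> /zA Az; exact: AB Az Bz.
Qed.

Lemma DU_semiDU A B : DU A B -> semiDU A B.
Proof.
move=> du A' B' rA rB dis; have [f rf fP] := du A' B' rA rB dis.
by exists f => // x; have [[? _] [? _]] := fP x.
Qed.

(** One disjoint pair is universal for all pairs of RE relations: its elements
    are the numbers <<<<e1, e2>>, <<x, y>>>> such that, on (x, y), the term
    number e1 halts and does so before the term number e2, respectively the
    other way round. A semi-reduction of this pair to (A, B) is a separation
    function, with h = <<e1, e2>>. *)
Lemma semiDU_SF A B : semiDU A B -> SF A B.
Proof.
pose pt n := ccons (unpair1 (unpair2 n)) (ccons (unpair2 (unpair2 n)) 0).
have semi (e e' : nat -> nat) : recursive1 e -> recursive1 e' ->
    RE [set n | exists p, halts_first (e n) (e' n) (pt n) p].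
  move=> re re'; apply: RE_semidecidable.
  exists (fun p v => halts_first (e (var 0 v)) (e' (var 0 v)) (pt (var 0 v)) p) => //.
  by apply: computable_halts_first; rewrite /pt; computability.
pose num1 n := unpair1 (unpair1 n); pose num2 n := unpair2 (unpair1 n).
have rnum1 : recursive1 num1 by apply/recursive1P; rewrite /num1; computability.
have rnum2 : recursive1 num2 by apply/recursive1P; rewrite /num2; computability.
move=> du; have [|f rf fP] := du _ _ (semi _ _ rnum1 rnum2) (semi _ _ rnum2 rnum1).
  by apply/disjointP => n /= [p hp] [q]; apply/negP; exact: halts_first_asym hp.
exists (fun h x y => f <<h, <<x, y>>>>); first by computability.
move=> M1 M2 [e1 M1P] [e2 M2P]; exists <<e1, e2>> => x y.
have [fA fB] := fP <<<<e1, e2>>, <<x, y>>>>.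
have ptE : pt <<<<e1, e2>>, <<x, y>>>> = code [:: x; y].
  by rewrite /pt !unpair2K !unpair1K.
have MP (M : nat -> nat -> Prop) e : (forall x y, M x y <-> exists z, kleeneT e [:: x; y] z) ->
    M x y <-> exists p, halting_witness e (code [:: x; y]) p.
  by move=> ->; exact: halting_witnessP.
have {}M1P := MP _ _ M1P; have {}M2P := MP _ _ M2P.
split=> -[yes no]; [apply: fA | apply: fB];
  rewrite /= ptE /num1 /num2 !unpair1K !unpair2K.
- by apply: halts_first_exists; [exact/M1P | move/M2P].
- by apply: halts_first_exists; [exact/M2P | move/M1P].
Qed.

(** Let M2(z, w) and M1(z, w) say that S(w, z, w) lies in W_i and in W_j, for
    z = <<i, j>>. At w = h, the index granted for M1 and M2, they speak of
    S(h, z, h), which is the required point. *)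
Lemma SF_KP A B : SF A B -> KP A B.
Proof.
case=> S rS SP.
have re2 (k : nat -> nat) : recursive1 k -> RE2 (fun z w => W (k z) (S w z w)).
  move=> rk; apply: RE2_semidecidable.
  exists (fun p v => halting_witness (k (var 0 v))
    (ccons (S (var 1 v) (var 0 v) (var 1 v)) 0) p).
    by computability.
  by move=> v _; rewrite W_witness.
have [h hP] := SP _ _ (re2 _ recursive1_unpair2) (re2 _ recursive1_unpair1).
exists (fun i j => S h <<i, j>> h); first by computability.
move=> i j; have := hP <<i, j>> h; rewrite unpair1K unpair2K => -[zA zB].
by split=> -[]; [move=> *; exact: zA | move=> *; exact: zB].
Qed.

Lemma DG_semiDG A B : DG A B -> semiDG A B.
Proof.
case=> f rf fP; exists f => // i j dij; have [fA fB] := fP i j dij.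
by split=> [/fA|/fB].
Qed.

(** W_j and W_i are replaced by disjoint subsets that still cover their
    differences; indices of these are computed from i and j. *)
Lemma semiDG_KP A B : semiDG A B -> KP A B.
Proof.
case=> f rf fP.
have semi k l : semidecidable 5 (fun v =>
    exists p, halts_first (var k v) (var l v) (ccons (var 0 v) 0) p).
  exists (fun p v => halts_first (var k v) (var l v) (ccons (var 0 v) 0) p) => //.
  by apply: computable_halts_first; computability.
have [t1 [t2 [rt1 rt2 tP]]] := @double_recursion
  (fun x i j _ _ => exists p, halts_first j i (ccons x 0) p)
  (fun x i j _ _ => exists p, halts_first i j (ccons x 0) p)
  (semi 2 1) (semi 1 2).
exists (fun i j => f (t1 i j) (t2 i j)); first by computability.
move=> i j; have [W1 W2] := tP i j.
have [|zA zB] := fP (t1 i j) (t2 i j).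
  rewrite W1 W2; apply/disjointP => x /= [p hp] [q]; apply/negP.
  exact: halts_first_asym hp.
split=> -[/W_witness yes no]; [apply: zA; rewrite W1 | apply: zB; rewrite W2];
  by apply: halts_first_exists => // /W_witness.
Qed.

Theorem theorem2p16 (A B : set nat) (hA : RE A) (hB : RE B)
    (hAB : A `&` B = set0) :
  ((KP A B -> CEI A B) /\
   (CEI A B -> EI A B) /\
   (EI A B -> WEI A B) /\
   (WEI A B -> DG A B) /\
   (DG A B -> DCP A B) /\
   (DCP A B -> WDCP A B) /\
   (WDCP A B -> DU A B) /\
   (DU A B -> semiDU A B) /\
   (semiDU A B -> SF A B) /\
   (SF A B -> KP A B) /\
   (DG A B -> semiDG A B) /\
   (semiDG A B -> KP A B)) /\
  ((KP A B <-> EI A B) /\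
   (SF A B <-> EI A B) /\
   (WEI A B <-> EI A B) /\
   (CEI A B <-> EI A B) /\
   (semiDG A B <-> EI A B) /\
   (DG A B <-> EI A B) /\
   (semiDU A B <-> EI A B) /\
   (DU A B <-> EI A B) /\
   (WDCP A B <-> EI A B) /\
   (DCP A B <-> EI A B)).
Proof.
have h1 := @KP_CEI A B; have h2 := @CEI_EI A B; have h3 := EI_WEI hAB.
have h4 := WEI_DG hA hB hAB; have h5 := @DG_DCP A B; have h6 := @DCP_WDCP A B.
have h7 := WDCP_DU hAB; have h8 := @DU_semiDU A B; have h9 := @semiDU_SF A B.
have h10 := @SF_KP A B; have h11 := @DG_semiDG A B; have h12 := @semiDG_KP A B.
by tauto.
Qed.
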